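(* There exist universal constants $c>0$ and $c'>0$ with the following property. Let $n\geqslant 2$ be an integer and let $D\geqslant 1$. If $\mathcal{M}=(M,\varrho)$ is a finite metric space such that every connected graph on $n$ vertices embeds into $\mathcal{M}$ with distortion at most $D$, then $$|M|\geqslant c'\exp\big(n^{c/D}\big).$$
   Context: Graphs are finite and simple; a connected graph $G$ is viewed as a metric space with the shortest-path distance $\mathrm{dist}_G$ on its vertex set $V_G$. A graph $G$ embeds into $\mathcal{M}=(M,\varrho)$ with distortion at most $D$ if there exist a map $f\colon V_G\to M$ and a scaling factor $s>0$ such that $s\,\mathrm{dist}_G(v,u)\leqslant\varrho(f(v),f(u))\leqslant sD\,\mathrm{dist}_G(v,u)$ for all $v,u\in V_G$. *)

(* Defs.v *)
Set Warnings "-notation-overridden,-notation-incompatible-prefix,-ambiguous-paths".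
From mathcomp Require Import all_boot all_order all_algebra.
From mathcomp Require Import finmap.
From mathcomp Require Import all_classical all_reals all_analysis.

Set Implicit Arguments.
Unset Strict Implicit.
Unset Printing Implicit Defensive.

Import Order.TTheory GRing.Theory Num.Theory.

Local Open Scope ring_scope.

Record sgraph (V : finType) := SGraph {
  adj :> rel V;
  adj_sym : symmetric adj;
  adj_irrefl : irreflexive adj
}.

Definition connected_graph (V : finType) (G : sgraph V) : Prop :=
  forall x y : V, connect G x y.

Definition has_walk (V : finType) (G : sgraph V) (x y : V) (k : nat) : bool :=
  [exists p : k.-tuple V, path G x p && (last x p == y)].

(* The least length of a walk from x to y. A shortest walk visits each vertex
   at most once, so its length is less than #|V|; the value is #|V| when no
   walk exists. *)
Definition gdist (V : finType) (G : sgraph V) (x y : V) : nat :=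
  find (has_walk G x y) (iota 0 #|V|).

Lemma has_walkP (V : finType) (G : sgraph V) (x y : V) (k : nat) :
  reflect (exists p : seq V, [/\ path G x p, last x p = y & size p = k])
          (has_walk G x y k).
Proof.
apply: (iffP existsP) => [[p /andP[pp /eqP lp]]|[p [pp lp /eqP sp]]].
  by exists p; rewrite pp lp size_tuple.
by exists (Tuple sp); rewrite /= pp lp eqxx.
Qed.

Lemma gdist_walk (V : finType) (G : sgraph V) (x y : V) :
  connect G x y ->
  exists p : seq V, [/\ path G x p, last x p = y & size p = gdist G x y].
Proof.
case/connectP => p0 /shortenP[p pp up _] yE.
have ltp : (size p < #|V|)%N by rewrite -[(size p).+1]/(size (x :: p)) -(card_uniqP up) max_card.
have hasw : has (has_walk G x y) (iota 0 #|V|).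
  by apply/hasP; exists (size p); [rewrite mem_iota | apply/has_walkP; exists p].
have := nth_find 0%N hasw; rewrite nth_iota; last first.
  by rewrite -[X in (_ < X)%N](size_iota 0) -has_find.
by move/has_walkP.
Qed.

Lemma gdist_min (V : finType) (G : sgraph V) (x y : V) (p : seq V) :
  path G x p -> last x p = y -> (gdist G x y <= size p)%N.
Proof.
move=> pp lp; rewrite leqNgt; apply/negP => lt_p.
have := before_find 0%N lt_p; rewrite nth_iota ?add0n.
  by move/has_walkP; apply; exists p.
by rewrite (leq_trans lt_p) // -[leqRHS](size_iota 0) find_size.
Qed.

Definition embeds_with_distortion (R : realType) (V : finType) (G : sgraph V)
    (M : metricType R) (D : R) : Prop :=
  exists (f : V -> M) (s : R), 0 < s /\
    forall v u : V,
      s * (gdist G v u)%:R <= mdist (f v) (f u) <= s * D * (gdist G v u)%:R.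

(* Main.v *)
(** Encode a k-tuple of permutations of n points by the graph having an edge
    between x and each s_i(x), together with a Hamiltonian path that makes it
    connected; its degrees are at most 2k + 2. Given an embedding f with
    distortion D, let t be the largest length of the image of an edge. All
    edges have image of length at most t, while points whose images are within
    t are at graph distance at most D, so each vertex has at most
    (2k + 3)^D such partners. Hence f and one edge attaining t leave at most
    (2k + 3)^D choices for each s_i(x), and
    (n!)^k <= |M|^n n^2 (2k + 3)^(D k n). Taking 2k + 3 close to n^(1/(4D))
    gives n^k <= (|M| n)^4, which is stronger than the claim. *)

Require Import Defs.
From mathcomp Require Import all_boot all_order all_algebra all_fingroup.
From mathcomp Require Import finmap.
From mathcomp Require Import all_classical all_reals all_analysis.
From mathcomp Require Import zify ring lra.

Set Implicit Arguments.
Unset Strict Implicit.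

Local Open Scope classical_set_scope.
Local Open Scope ring_scope.

Import Order.TTheory GRing.Theory Num.Theory.

Lemma leq_wexp2r (m n e : nat) : (m <= n -> m ^ e <= n ^ e)%N.
Proof. by case: e => // e; rewrite leq_exp2r. Qed.

(** Pairing the factors i + 1 and n - i of the two copies of n! gives n products, each at least
    n. *)
Lemma expnn_leq_fact_sqr (n : nat) : (n ^ n <= n`! ^ 2)%N.
Proof.
have rev : \prod_(i < n) i.+1 = n`! by rewrite fact_prod big_add1 big_mkord.
rewrite expnS expn1 -{1}rev (reindex_inj rev_ord_inj) /= -rev -big_split /=.
rewrite -[X in (n ^ X)%N]card_ord -prod_nat_const; apply: leq_prod => i _.
have := ltn_ord i; nia.
Qed.

(** * Size of balls in graphs of bounded degree *)

Definition sym_graph (V : finType) (e : rel V) : sgraph V.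
Proof.
exists (fun x y => (x != y) && (e x y || e y x)).
- by move=> x y; rewrite eq_sym orbC.
- by move=> x; rewrite eqxx.
Defined.

Lemma gdist0 (V : finType) (G : sgraph V) (x : V) : gdist G x x = 0%N.
Proof. by apply/eqP; rewrite -leqn0; apply: (@gdist_min _ G x x [::]). Qed.

Lemma leq_card_bigcup (I T : finType) (A : {pred I}) (F : I -> {set T}) :
  (#|(\bigcup_(i in A) F i)%SET| <= \sum_(i in A) #|F i|)%N.
Proof.
elim/big_ind2: _ => [|a1 b1 a2 b2 le1 le2|//]; first by rewrite cards0.
by rewrite (leq_trans (leq_card_setU _ _)) // leq_add.
Qed.

(** By induction on r: the balls of radius r about the at most d points of the closed neighbourhood
    of x cover the ball of radius r + 1 about x. *)
Lemma card_ball (V : finType) (G : sgraph V) (d r : nat) (x : V) :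
  connected_graph G ->
  (forall y, #|[pred z | (z == y) || G y z]| <= d)%N ->
  (#|[pred y | (gdist G x y <= r)%N]| <= d ^ r)%N.
Proof.
move=> Gconn deg; elim: r x => [|r IHr] x.
  rewrite expn0 -(card1 x); apply/subset_leq_card/fintype.subsetP => y.
  rewrite !inE leqn0 => /eqP xy0.
  by case: (gdist_walk (Gconn x y)) => -[|z p] [_ /= lp]; rewrite ?lp // xy0.
have sub : [pred y | (gdist G x y <= r.+1)%N] \subset
    (\bigcup_(z in [pred z | (z == x) || G x z])
      [set y | (gdist G z y <= r)%N])%SET.
  apply/fintype.subsetP => y; rewrite inE => le_xy; apply/finset.bigcupP.
  case: (gdist_walk (Gconn x y)) => -[|z p] [/= pp lp sp].
    by exists x; rewrite ?inE ?eqxx // -lp gdist0.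
  case/andP: pp => xz pp; exists z; first by rewrite inE xz orbT.
  rewrite inE (leq_trans (gdist_min pp lp)) //.
  by rewrite -ltnS (leq_trans _ le_xy) // -sp.
apply: (leq_trans (subset_leq_card sub)).
apply: (leq_trans (leq_card_bigcup _ _)) => /=.
apply: (@leq_trans (\sum_(z in [pred z | (z == x) || G x z]) d ^ r)%N).
  by apply: leq_sum => z _; rewrite cardsE IHr.
by rewrite sum_nat_const expnS leq_mul2r deg orbT.
Qed.

(** * Counting tuples of permutations by codes *)

(** The tuple s is determined by its code c together with, for each i and x, the position of [s i x]
    in the enumeration of [P c x], which is a number below B. *)
Lemma fact_exp_le_card_codes (k n B : nat) (C : finType) (P : C -> 'I_n -> pred 'I_n) :
  (forall s : {ffun 'I_k -> 'S_n}, exists c,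
     (forall x, #|P c x| <= B)%N /\ forall i x, P c x (s i x)) ->
  (0 < B)%N -> (n`! ^ k <= #|C| * B ^ (k * n))%N.
Proof.
case: B => // B + _ => /boolp.choice[code codeP].
have -> : (n`! ^ k = #|{: {ffun 'I_k -> 'S_n}}|)%N.
  by rewrite card_ffun card_ord card_Sn.
have -> : (#|C| * B.+1 ^ (k * n) = #|{: C * {ffun 'I_k * 'I_n -> 'I_B.+1}}|)%N.
  by rewrite card_prod card_ffun card_prod !card_ord.
pose h s := (code s, [ffun ix : 'I_k * 'I_n =>
  inord (index (s ix.1 ix.2) (enum (P (code s) ix.2))) : 'I_B.+1]).
apply: (@leq_card _ _ h) => s t [eq_code /ffunP eq_index].
apply/ffunP => i; apply/permP => x; have /= := eq_index (i, x).
have [cardP Ps] := codeP s; have [_ Pt] := codeP t; rewrite -eq_code in Pt.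
have lt_index (y : 'I_n) : P (code s) x y ->
    (index y (enum (P (code s) x)) < B.+1)%N.
  move=> Py; rewrite (leq_trans _ (cardP x)) // cardE.
  by rewrite index_mem mem_enum.
rewrite !ffunE /= -eq_code => /(congr1 val) /=.
rewrite !inordK ?lt_index // => eqi.
have := nth_index (s i x) (_ : s i x \in enum (P (code s) x)).
rewrite mem_enum => /(_ (Ps i x)) <-; rewrite eqi nth_index //.
by rewrite mem_enum; exact: Pt.
Qed.

(** * The graph of a tuple of permutations *)

Definition perm_edge (k n : nat) (s : {ffun 'I_k -> 'S_n}) : rel 'I_n :=
  fun x y => (val y == x.+1) || [exists i, y == s i x].

Definition perm_graph (k n : nat) (s : {ffun 'I_k -> 'S_n}) : sgraph 'I_n :=
  sym_graph (perm_edge s).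

Lemma perm_graph_connected (k n : nat) (s : {ffun 'I_k -> 'S_n}) :
  connected_graph (perm_graph s).
Proof.
have Gsym : connect_sym (perm_graph s).
  by apply: sym_connect_sym; apply: adj_sym.
suff low m (x y : 'I_n) : y = (x + m)%N :> nat -> connect (perm_graph s) x y.
  move=> x y; have [le_xy|/ltnW le_yx] := leqP x y.
    by apply: (low (y - x)%N); rewrite subnKC.
  by rewrite Gsym; apply: (low (x - y)%N); rewrite subnKC.
elim: m y => [|m IHm] y yE.
  have -> : y = x by apply: ord_inj; rewrite yE addn0.
  exact: connect0.
have lt_n : (x + m < n)%N by have := ltn_ord y; lia.
apply: (connect_trans (IHm (Ordinal lt_n) erefl)); apply: connect1.
rewrite /= /perm_edge /= yE addnS eqxx andbT.
by apply/eqP => /(congr1 val) /=; lia.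
Qed.

Lemma perm_graph_degree (k n : nat) (s : {ffun 'I_k -> 'S_n}) (y : 'I_n) :
  (#|[pred z | (z == y) || perm_graph s y z]| <= 2 * k + 3)%N.
Proof.
case: n s y => [s [] //|n s y].
(* At the ends of the path an entry of the list may fail to be a neighbour; this is harmless, as the
   list only has to contain the closed neighbourhood. *)
pose nbrs : seq 'I_n.+1 := [:: y; inord y.+1; inord y.-1] ++
  [seq s i y | i <- enum 'I_k] ++ [seq (s i)^-1%g y | i <- enum 'I_k].
have -> : (2 * k + 3 = size nbrs)%N.
  by rewrite /nbrs !size_cat !(size_map _ (enum 'I_k)) -cardE card_ord /=; lia.
apply: leq_trans (card_size _); apply/subset_leq_card/fintype.subsetP => z.
rewrite !inE /nbrs !mem_cat /= /perm_edge.
have ordE (x : 'I_n.+1) m : x = m :> nat -> x = inord m by move=> <-; rewrite inord_val.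
case: eqVneq => [//|_] /= /orP[]/orP[/eqP zE|/existsP[i /eqP zE]].
- by rewrite (ordE _ _ zE) eqxx.
- by apply/orP; right; apply/orP; right; apply/orP; left; rewrite zE map_f // mem_enum.
- by rewrite (ordE z y.-1) ?eqxx ?orbT // zE.
- do 3!(apply/orP; right); rewrite -[z](permK (s i)) -zE.
  by apply: (map_f (fun i => (s i)^-1%g y)); rewrite mem_enum.
Qed.

Lemma fact_exp_le_universal (R : realType) (n k : nat) (D : R) (M : metricType R) :
  (0 < n)%N -> 1 <= D -> finite_set [set: M] ->
  (forall G : sgraph 'I_n, connected_graph G -> embeds_with_distortion G M D) ->
  (n`! ^ k <= (#|` fset_set [set: M] | ^ n * n ^ 2) *
     ((2 * k + 3) ^ Num.truncn D) ^ (k * n))%N.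
Proof.
case: n => // n _ D1 finM emb; set A := fset_set [set: M].
have inA z : z \in A by rewrite in_fset_set // inE.
pose C : finType := ({ffun 'I_n.+1 -> A} * ('I_n.+1 * 'I_n.+1))%type.
pose P (c : C) x y := mdist (val (c.1 x)) (val (c.1 y)) <=
  mdist (val (c.1 c.2.1)) (val (c.1 c.2.2)).
have -> : (#|` A| ^ n.+1 * n.+1 ^ 2 = #|C|)%N.
  by rewrite !card_prod card_ffun !card_ord -cardfE.
apply: (@fact_exp_le_card_codes k n.+1 _ C P) => [s|]; last by rewrite expn_gt0 addn3.
set G := perm_graph s; have Gconn : connected_graph G by exact: perm_graph_connected.
case: (emb G Gconn) => f [a [a0 fP]].
(* Admitting the diagonal makes this set nonempty even for a single vertex, and covers the case of a
   fixed point of [s i]. *)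
pose near_edge := [pred e : 'I_n.+1 * 'I_n.+1 | (gdist G e.1 e.2 <= 1)%N].
have near0 : near_edge (ord0, ord0) by rewrite /= gdist0.
case: (arg_maxP (fun e => mdist (f e.1) (f e.2)) near0) => e near_e max_e.
exists ([ffun x => [` inA (f x)]%fset], e); split=> [x|i x].
  apply: leq_trans (card_ball _ x Gconn (perm_graph_degree s)).
  apply/subset_leq_card/fintype.subsetP => y.
  rewrite !inE /in_mem /= /P !ffunE /= => le_xy.
  (* The distance is an integer, so the bound D suffices. It follows by cancelling [a] in a dist(x,
     y) <= |f x, f y| <= |f e.1, f e.2| <= a D. *)
  rewrite truncn_ge_nat ?(le_trans ler01) //.
  rewrite -(ler_pM2l a0); have /andP[le1 _] := fP x y.
  have /andP[_ le2] := fP e.1 e.2.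
  apply: (le_trans le1); apply: (le_trans le_xy); apply: (le_trans le2).
  rewrite ler_piMr ?mulr_ge0 ?(ltW a0) ?(le_trans ler01) //.
  by rewrite (ler_nat R _ 1).
rewrite /P !ffunE /=; apply: (max_e (x, s i x)).
rewrite /near_edge /=; have [->|neq] := eqVneq (s i x) x; first by rewrite gdist0.
apply: (@gdist_min _ G x (s i x) [:: s i x]) => //=.
rewrite andbT eq_sym neq /perm_edge.
by apply/orP; left; apply/orP; right; apply/existsP; exists i.
Qed.

(** With T = n^(kn), the fourth power of the hypothesis gives T^2 <= (N^n n^2)^4 T. Cancel T, bound
    n^2 by n^n and take n-th roots. *)
Lemma expn_le_of_fact_le (n k N B : nat) : (1 < n)%N -> (B ^ 4 <= n)%N ->
  (n`! ^ k <= (N ^ n * n ^ 2) * B ^ (k * n))%N -> (n ^ k <= (N * n) ^ 4)%N.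
Proof.
move=> n1 Bn le_fact; have n0 : (0 < n)%N by exact: ltnW.
set T := ((n ^ k) ^ n)%N; have T0 : (0 < T)%N by rewrite !expn_gt0 n0.
have leT : (T <= (n`! ^ k) ^ 2)%N.
  by rewrite /T -[leqLHS]expnM -[leqRHS]expnM mulnC [(k * 2)%N]mulnC 2!expnM
    leq_wexp2r ?expnn_leq_fact_sqr.
have leB : ((B ^ (k * n)) ^ 4 <= T)%N.
  by rewrite /T -!expnM [(_ * 4)%N]mulnC expnM leq_wexp2r.
have leN : (T ^ 2 <= (N ^ n * n ^ 2) ^ 4 * T)%N.
  apply: (@leq_trans (((n`! ^ k) ^ 2) ^ 2)%N); first exact: leq_wexp2r.
  apply: (@leq_trans ((N ^ n * n ^ 2 * B ^ (k * n)) ^ 4)%N).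
    by rewrite -expnM leq_wexp2r.
  by rewrite expnMn leq_mul2l leB orbT.
move: leN; rewrite expnS expn1 leq_pmul2r // => leN.
rewrite -(@leq_exp2r _ _ n) //; apply: (leq_trans leN).
rewrite -[leqRHS]expnM [(4 * n)%N]mulnC expnM leq_wexp2r // expnMn.
by rewrite leq_mul2l leq_pexp2l ?orbT.
Qed.

(** From exp(-1/2) >= 1 - 1/2, by squaring and inverting. *)
Lemma expR1_le4 (R : realType) : expR 1 <= 4%:R :> R.
Proof.
have half : 2^-1 <= expR (- 2^-1) :> R.
  by apply: le_trans (expR_ge1Dx _); lra.
have -> : expR 1 = (expR (- 2^-1) ^+ 2)^-1 :> R.
  by rewrite -expRM_natl -expRN; congr expR; lra.
rewrite invf_ple ?posrE ?exprn_gt0 ?expR_gt0 //.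
apply: le_trans (_ : 2^-1 ^+ 2 <= _); first lra.
by rewrite lerXn2r ?nnegrE ?expR_ge0.
Qed.

(* The lower bound on n ensures log n >= 8, so that (k - 4) log n / 4 dominates
   X - 16. *)
Lemma expR_le_of_expn_le (R : realType) (n N k : nat) (X : R) :
  (8 ^ 4 * 2 ^ 4 <= n)%N -> X <= (2 * k + 5)%:R -> (4 < k)%N ->
  (n ^ k <= (N * n) ^ 4)%N -> expR (X - 16) <= N%:R.
Proof.
move=> n_big Xk k4 le_N; have n0 : (0 < n)%N by apply: leq_trans n_big.
(* Here e^8 <= 4^8 = 2^16 = 8^4 2^4. *)
have e8 : expR 8 <= n%:R :> R.
  rewrite -[8]mulr1 expRM_natl; apply: (@le_trans _ _ (4 ^+ 8)).
    by rewrite lerXn2r ?nnegrE ?expR_ge0 ?expR1_le4.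
  by rewrite -natrX ler_nat (leq_trans _ n_big).
have le_N4 : (n ^ (k - 4) <= N ^ 4)%N.
  by rewrite -(@leq_pmul2r (n ^ 4)) ?expn_gt0 ?n0 // -expnD subnK ?(ltnW k4) // -expnMn.
rewrite -(@ler_pXn2r _ 4) ?nnegrE ?expR_ge0 //.
apply: (@le_trans _ _ (expR 8 ^+ (k - 4))).
  rewrite -!expRM_natl ler_expR natrB ?(ltnW k4) //.
  by move: Xk; rewrite natrD natrM; lra.
apply: (@le_trans _ _ (n%:R ^+ (k - 4))); last by rewrite -!natrX ler_nat.
by rewrite lerXn2r ?nnegrE ?expR_ge0.
Qed.

Theorem corollary1p12 (R : realType) :
  exists c c' : R, [/\ 0 < c, 0 < c' &
    forall (n : nat) (D : R) (M : metricType R),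
      (2 <= n)%N -> 1 <= D -> finite_set [set: M] ->
      (forall G : sgraph 'I_n, connected_graph G ->
         embeds_with_distortion G M D) ->
      c' * expR (n%:R `^ (c / D)) <= #|` fset_set [set: M] |%:R].
Proof.
(* With c = 1/4 the number X = n^(c/D) satisfies X^(4D) = n; the factor exp(-16) makes the case X <=
   16 trivial. *)
exists 4^-1, (expR (- 16)); split; rewrite ?expR_gt0 // => n D M n2 D1 finM emb.
have n0 : (0 < n)%N by exact: ltnW.
have card_le k := @fact_exp_le_universal R n k D M n0 D1 finM emb.
set N := #|` _|%fset in card_le *; set X := _ `^ _; rewrite -expRD addrC.
(* The count for k = 0 reads 1 <= N^n n^2, which excludes N = 0. *)
have N0 : (0 < N)%N.
  by have := card_le 0%N; rewrite lt0n; case: (N) => //; rewrite exp0n.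
have [X16|/ltW X16] := leP X 16.
  apply: (@le_trans _ _ 1); last by rewrite ler1n.
  by rewrite -[leRHS]expR0 ler_expR subr_le0.
have D0 : 0 < D by exact: lt_le_trans ltr01 D1.
have X1 : 1 <= X by apply: le_trans X16; lra.
have nE : X `^ (4 * D) = n%:R.
  rewrite -powRrM (_ : _ / D * _ = 1) ?powRr1 //.
  by field; rewrite gt_eqF.
have X_le_n (m : nat) : m%:R <= D -> X ^+ (4 * m) <= n%:R.
  move=> mD; rewrite -nE -powR_mulrn ?(le_trans ler01) // natrM.
  by rewrite ler_powR // ler_pM2l.
(* This is the largest k with 2k + 3 <= X, so the fourth power of the ball bound is at most X^(4D) =
   n, while X < 2k + 5. *)
pose k := Num.truncn ((X - 3) / 2).
have /andP[k_le k_gt] : k%:R <= (X - 3) / 2 < k.+1%:R.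
  by apply: truncn_itv; lra.
have nat_le : (n ^ k <= (N * n) ^ 4)%N.
  apply: (@expn_le_of_fact_le n k N ((2 * k + 3) ^ Num.truncn D)) => //.
  rewrite -expnM [(_ * 4)%N]mulnC -(ler_nat R); apply: le_trans (X_le_n (Num.truncn D) _).
    by rewrite natrX lerXn2r ?nnegrE // ?natrD ?natrM; lra.
  by rewrite truncn_le ltW.
apply: (@expR_le_of_expn_le R n N k) => //.
(* Since D >= 1 and X >= 16, n >= X^4 >= 16^4. *)
- rewrite -expnMn -(ler_nat R); apply: le_trans (X_le_n 1%N D1).
  by rewrite natrX lerXn2r ?nnegrE // (le_trans _ X16).
- by move: k_gt; rewrite -natr1 natrD natrM; lra.
- by rewrite -ltnS -(ltr_nat R); apply: le_lt_trans k_gt; lra.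
Qed.
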